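(* Let $N\ge2$, $\delta\in\{0,1\}$, and let $a_{21},b_1,b_2\ge0$ be parameters of an explicit second order two-stage Runge-Kutta scheme, i.e. $b_1+b_2=1$ and $a_{21}b_2=\frac12$. The two-stage modified Patankar-Runge-Kutta scheme $$y_i^{(1)}=y_i^n,$$ $$y_i^{(2)}=y_i^n+a_{21}\Delta t\sum_{j=1}^N\Bigl(p_{ij}(\mathbf y^{(1)})(1-\delta)+p_{ij}(\mathbf y^{(1)})\frac{y_j^{(2)}}{\pi_j}\delta-d_{ij}(\mathbf y^{(1)})\frac{y_i^{(2)}}{\pi_i}\Bigr),$$ $$y_i^{n+1}=y_i^n+\Delta t\sum_{j=1}^N\Bigl(\bigl(b_1p_{ij}(\mathbf y^{(1)})+b_2p_{ij}(\mathbf y^{(2)})\bigr)\frac{y_j^{n+1}}{\sigma_j}-\bigl(b_1d_{ij}(\mathbf y^{(1)})+b_2d_{ij}(\mathbf y^{(2)})\bigr)\frac{y_i^{n+1}}{\sigma_i}\Bigr),$$ $i=1,\dots,N$, with $\pi_i=y_i^n$ and $\sigma_i=y_i^{(2)}$ for $i=1,\dots,N$, is second order accurate if and only if $a_{21}=1$.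
   Context: A production-destruction system (PDS) is an ODE system $y_i'(t)=P_i(\mathbf y(t))-D_i(\mathbf y(t))$, $i=1,\dots,N$, with $P_i(\mathbf y)=\sum_{j=1}^N p_{ij}(\mathbf y)$, $D_i(\mathbf y)=\sum_{j=1}^N d_{ij}(\mathbf y)$, where $p_{ij},d_{ij}\ge 0$ are defined for $\mathbf y\ge 0$ (componentwise) and are twice continuously differentiable on $(0,\infty)^N$. The PDS is positive if positive initial values imply positive solutions for all $t>0$. It is fully conservative if $p_{ij}(\mathbf y)=d_{ji}(\mathbf y)$ and $p_{ii}(\mathbf y)=d_{ii}(\mathbf y)=0$ for all $i,j$ and $\mathbf y\ge0$. All PDS considered are positive and fully conservative. Second order accurate means: for every positive fully conservative PDS with $N$ constituents and every $\mathbf y^n\in(0,\infty)^N$, if $\mathbf y(t)$ is the solution with $\mathbf y(t^n)=\mathbf y^n$ and $t^{n+1}=t^n+\Delta t$, then $y_i^{n+1}-y_i(t^{n+1})=\mathcal O(\Delta t^3)$ as $\Delta t\to0^+$ (PDS and $\mathbf y^n$ fixed) for $i=1,\dots,N$. *)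

(* Defs.v *)
From HB Require Import structures.
From mathcomp Require Import all_boot all_order all_algebra.
From mathcomp Require Import all_classical all_reals all_analysis.
From mathcomp Require Import ring lra.

Set Implicit Arguments.
Unset Strict Implicit.
Unset Printing Implicit Defensive.

Import Order.TTheory GRing.Theory Num.Theory.
Import numFieldNormedType.Exports.

Local Open Scope classical_set_scope.
Local Open Scope ring_scope.

Definition pos_vec {R : realType} {N : nat} (y : 'rV[R]_N) : Prop :=
  forall i, 0 < y 0 i.

Definition nonneg_vec {R : realType} {N : nat} (y : 'rV[R]_N) : Prop :=
  forall i, 0 <= y 0 i.

(* [U] is meant to be open: continuity and derivatives at the points of [U]
   are those of the total function [f], which then only depend on [f]
   restricted to [U]. *)
Fixpoint Ck_on {R : realType} {N : nat} (U : set 'rV[R]_N) (k : nat)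
    (f : 'rV[R]_N -> R) : Prop :=
  (forall y, U y -> {for y, continuous f}) /\
  if k is k'.+1 then
    forall j : 'I_N,
      (forall y, U y -> derivable f y (delta_mx 0 j)) /\
      Ck_on U k' (fun y => 'D_(delta_mx 0 j) f y)
  else True.

(* The rates are total functions; their values outside the closed nonnegative
   orthant are junk and never constrained nor used. *)
Record pds (R : realType) (N : nat) := Pds {
  prod_rate : 'I_N -> 'I_N -> 'rV[R]_N -> R;
  dest_rate : 'I_N -> 'I_N -> 'rV[R]_N -> R;
  prod_rate_ge0 : forall i j y, nonneg_vec y -> 0 <= prod_rate i j y;
  dest_rate_ge0 : forall i j y, nonneg_vec y -> 0 <= dest_rate i j y;
  prod_rate_C2 : forall i j, Ck_on pos_vec 2 (prod_rate i j);
  dest_rate_C2 : forall i j, Ck_on pos_vec 2 (dest_rate i j)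
}.

Definition prod_term {R : realType} {N : nat} (S : pds R N) (i : 'I_N)
    (y : 'rV[R]_N) : R := \sum_(j < N) prod_rate S i j y.

Definition dest_term {R : realType} {N : nat} (S : pds R N) (i : 'I_N)
    (y : 'rV[R]_N) : R := \sum_(j < N) dest_rate S i j y.

(* Solutions on [t0, +oo) take their values where the rates are defined. At
   the left endpoint only continuity from the right is required. *)
Definition pds_solution {R : realType} {N : nat} (S : pds R N) (t0 : R)
    (y0 : 'rV[R]_N) (y : R -> 'rV[R]_N) : Prop :=
  [/\ y t0 = y0,
      forall t, t0 <= t -> nonneg_vec (y t),
      {within `[t0, +oo[, continuous y} &
      forall t, t0 < t -> forall i,
        is_derive t 1 (fun s => y s 0 i)
          (prod_term S i (y t) - dest_term S i (y t))].

Definition positive_pds {R : realType} {N : nat} (S : pds R N) : Prop :=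
  forall y0, pos_vec y0 ->
    (exists y, pds_solution S 0 y0 y) /\
    (forall y, pds_solution S 0 y0 y -> forall t, 0 < t -> pos_vec (y t)).

Definition fully_conservative {R : realType} {N : nat} (S : pds R N) : Prop :=
  forall y, nonneg_vec y ->
    (forall i j, prod_rate S i j y = dest_rate S j i y) /\
    (forall i, prod_rate S i i y = 0 /\ dest_rate S i i y = 0).

(* [M S dt yn ynew]: one step of size [dt] of the method [M] for [S], started
   at [yn], yields [ynew]. *)
Definition one_step_method (R : realType) (N : nat) : Type :=
  pds R N -> R -> 'rV[R]_N -> 'rV[R]_N -> Prop.

Definition second_order_accurate {R : realType} {N : nat}
    (M : one_step_method R N) : Prop :=
  forall S : pds R N, positive_pds S -> fully_conservative S ->
  forall (tn : R) (yn : 'rV[R]_N), pos_vec yn ->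
  forall y : R -> 'rV[R]_N, pds_solution S tn yn y ->
  forall ynew : R -> 'rV[R]_N,
    (\forall dt \near 0^'+, M S dt yn (ynew dt)) ->
  forall i : 'I_N,
    (fun dt : R => ynew dt 0 i - y (tn + dt) 0 i)
      =O_ (0^'+) (fun dt : R => dt ^+ 3).

Definition mprk_eqs {R : realType} {N : nat} (delta a21 b1 b2 : R)
    (S : pds R N) (pi sigma : 'rV[R]_N) (dt : R)
    (yn y1 y2 ynew : 'rV[R]_N) : Prop :=
  let p := prod_rate S in let d := dest_rate S in
  [/\ forall i, y1 0 i = yn 0 i,
      forall i, y2 0 i = yn 0 i + a21 * dt * \sum_(j < N)
        (p i j y1 * (1 - delta) + p i j y1 * (y2 0 j / pi 0 j) * delta
         - d i j y1 * (y2 0 i / pi 0 i)) &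
      forall i, ynew 0 i = yn 0 i + dt * \sum_(j < N)
        ((b1 * p i j y1 + b2 * p i j y2) * (ynew 0 j / sigma 0 j)
         - (b1 * d i j y1 + b2 * d i j y2) * (ynew 0 i / sigma 0 i))].

Definition mprk {R : realType} {N : nat} (delta a21 b1 b2 : R) :
    one_step_method R N :=
  fun S dt yn ynew => exists y1 y2 : 'rV[R]_N,
    mprk_eqs delta a21 b1 b2 S yn y2 dt yn y1 y2 ynew.

(* v = b + (A - diag (column sums of A)) v, an M-matrix system with unit column
   sums; the coupled linear systems of the scheme have this form. *)
Lemma patankar_ge0 (R : realType) (N : nat) (A : 'M[R]_N) (b v : 'I_N -> R) :
  (forall i j, 0 <= A i j) -> (forall i, 0 <= b i) ->
  (forall i, v i = b i + \sum_j (A i j * v j - A j i * v i)) ->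
  forall i, 0 <= v i.
Proof.
move=> A0 b0 vE i0; rewrite leNgt; apply/negP => vi0.
pose S := [pred i | v i < 0].
have : \sum_(i | S i) v i < 0.
  rewrite (bigD1 i0) //=.
  have : \sum_(i | (v i < 0) && (i != i0)) v i <= 0.
    by apply: sumr_le0 => i /andP[/ltW].
  by lra.
rewrite (eq_bigr _ (fun i _ => vE i)) big_split /=.
suff h : 0 <= \sum_(i | S i) \sum_j (A i j * v j - A j i * v i).
  have : 0 <= \sum_(i | S i) b i by apply: sumr_ge0.
  by move: h; lra.
under eq_bigr => i _ do rewrite (bigID S) /= big_split /= sumrN.
rewrite big_split /= big_split /= sumrN [X in X - _]exchange_big /= subrr add0r.
apply: sumr_ge0 => i vi; apply: sumr_ge0 => j vj; rewrite /= in vi vj.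
rewrite -leNgt in vj; have := mulr_ge0 (A0 i j) vj.
have := mulr_ge0_le0 (A0 j i) (ltW vi); lra.
Qed.

Lemma patankar_solvable (R : realType) (N : nat) (A : 'M[R]_N) (b : 'rV[R]_N) :
  (forall i j, 0 <= A i j) -> pos_vec b ->
  exists2 v : 'rV[R]_N, pos_vec v &
    forall w : 'rV[R]_N, w = v <->
      forall i, w 0 i = b 0 i + \sum_j (A i j * w 0 j - A j i * w 0 i).
Proof.
move=> A0 bpos.
pose M := 1%:M + diag_mx (\row_i \sum_j A j i) - A^T.
have ME (w : 'rV[R]_N) i :
    (w *m M) 0 i = w 0 i - \sum_j (A i j * w 0 j - A j i * w 0 i).
  rewrite /M mulmxBr mulmxDr mulmx1 mul_mx_diag !mxE big_split /= sumrN.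
  rewrite opprB addrA mulr_sumr; congr (_ + _ - _).
    by apply: eq_bigr => j _; rewrite mulrC.
  by apply: eq_bigr => j _; rewrite !mxE mulrC.
have eqE (w c : 'rV[R]_N) : w *m M = c <->
    forall i, w 0 i = c 0 i + \sum_j (A i j * w 0 j - A j i * w 0 i).
  split=> [<- i|wE]; first by rewrite ME subrK.
  by apply/rowP => i; rewrite ME {1}wE addrK.
have Mu : M \in unitmx.
  rewrite -row_free_unit; apply: inj_row_free => w /eqE wE.
  have w0 i : 0 <= w 0 i.
    by apply: (@patankar_ge0 _ _ A (fun=> 0)) => // k; rewrite {1}wE mxE.
  have wN0 i : 0 <= - w 0 i.
    apply: (@patankar_ge0 _ _ A (fun=> 0) (fun k => - w 0 k)) => // k.
    rewrite {1}wE mxE !add0r -sumrN; apply: eq_bigr => j _; ring.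
  by apply/rowP => i; rewrite mxE; have := w0 i; have := wN0 i; lra.
exists (b *m invmx M); last first.
  move=> w; rewrite -eqE; split=> [->|<-]; first by rewrite mulmxKV.
  by rewrite mulmxK.
have /eqE vE : (b *m invmx M) *m M = b by rewrite mulmxKV.
move: (b *m invmx M) vE => v vE.
have v0 : forall i, 0 <= v 0 i.
  by apply: (@patankar_ge0 _ _ A (fun k => b 0 k)) => // i; exact: ltW.
move=> i; rewrite lt_neqAle v0 andbT eq_sym; apply/eqP => vi.
have := vE i; rewrite vi.
have : 0 <= \sum_j (A i j * v 0 j - A j i * 0).
  by apply: sumr_ge0 => j _; rewrite mulr0 subr0 mulr_ge0.
by have := bpos i; lra.
Qed.

(* Hence [second_order_accurate (mprk _ _ _ _)] is not vacuous, and the value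
   of a step is unambiguous. *)
Lemma mprk_solvable (R : realType) (N : nat) (delta a21 b1 b2 : R)
    (S : pds R N) (dt : R) (yn : 'rV[R]_N) :
  delta = 0 \/ delta = 1 -> 0 <= a21 -> 0 <= b1 -> 0 <= b2 ->
  fully_conservative S -> 0 <= dt -> pos_vec yn ->
  exists! ynew, mprk delta a21 b1 b2 S dt yn ynew.
Proof.
move=> dl a0 b10 b20 cons dt0 ynp.
have nn (y : 'rV[R]_N) : pos_vec y -> nonneg_vec y.
  by move=> yp i; exact: ltW.
pose p := prod_rate S.
have dE i j y : nonneg_vec y -> dest_rate S i j y = p j i y.
  by move=> /cons[pE _]; rewrite /p pE.
have p0 i j y : nonneg_vec y -> 0 <= p i j y by exact: prod_rate_ge0.
have pd (y : 'rV[R]_N) i : pos_vec y -> 0 <= (y 0 i)^-1.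
  by move=> yp; rewrite invr_ge0 ltW.
have [y2 y2p y2E] : exists2 y2 : 'rV[R]_N, pos_vec y2 &
    forall w : 'rV[R]_N, w = y2 <->
      forall i, w 0 i = yn 0 i + a21 * dt * \sum_(j < N)
        (p i j yn * (1 - delta) + p i j yn * (w 0 j / yn 0 j) * delta
         - dest_rate S i j yn * (w 0 i / yn 0 i)).
  case: dl => ->.
    pose D i := 1 + a21 * dt * \sum_j p j i yn / yn 0 i.
    have Dp i : 0 < D i.
      rewrite ltr_pwDl // !mulr_ge0 // sumr_ge0 // => j _.
      by rewrite mulr_ge0 ?p0 ?pd //; exact: nn.
    pose c i := yn 0 i + a21 * dt * \sum_j p i j yn.
    have cp i : 0 < c i.
      rewrite ltr_pwDl // !mulr_ge0 // sumr_ge0 // => j _.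
      by rewrite p0 //; exact: nn.
    exists (\row_i (c i / D i)); first by move=> i; rewrite mxE divr_gt0.
    have eqE (w : 'rV[R]_N) i : yn 0 i + a21 * dt * \sum_(j < N)
        (p i j yn * (1 - 0) + p i j yn * (w 0 j / yn 0 j) * 0
         - dest_rate S i j yn * (w 0 i / yn 0 i)) =
        c i - (D i - 1) * w 0 i.
      under eq_bigr => j _ do rewrite subr0 mulr1 mulr0 addr0 (dE _ _ _ (nn _ ynp)).
      rewrite big_split /= sumrN /c /D.
      have -> : \sum_j p j i yn * (w 0 i / yn 0 i) =
          (\sum_j p j i yn / yn 0 i) * w 0 i; last by ring.
      rewrite mulr_suml.
      by apply: eq_bigr => j _; ring.
    move=> w; split=> [-> i|wE].
      by rewrite eqE !mxE; field; rewrite gt_eqF.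
    apply/rowP => i; rewrite mxE; have := wE i; rewrite eqE => wi.
    apply: (canRL (mulfK (lt0r_neq0 (Dp i)))); lra.
  have [||y2 y2p y2E] := @patankar_solvable _ _
    (\matrix_(i, j) (a21 * dt * (p i j yn / yn 0 j))) yn.
  - by move=> i j; rewrite mxE !mulr_ge0 ?p0 ?pd //; exact: nn.
  - exact: ynp.
  exists y2 => // w; rewrite y2E.
  suff e i : \sum_j ((\matrix_(i, j) (a21 * dt * (p i j yn / yn 0 j))) i j * w 0 j
      - (\matrix_(i, j) (a21 * dt * (p i j yn / yn 0 j))) j i * w 0 i) =
      a21 * dt * \sum_(j < N)
        (p i j yn * (1 - 1) + p i j yn * (w 0 j / yn 0 j) * 1
         - dest_rate S i j yn * (w 0 i / yn 0 i)).
    by split=> wE i; rewrite {1}wE e.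
  rewrite mulr_sumr; apply: eq_bigr => j _; rewrite !mxE (dE _ _ _ (nn _ ynp)).
  by ring.
pose q i j := b1 * p i j yn + b2 * p i j y2.
have [||z zp zE] := @patankar_solvable _ _
    (\matrix_(i, j) (dt * (q i j / y2 0 j))) yn.
- move=> i j; rewrite mxE !mulr_ge0 ?pd // /q addr_ge0 // mulr_ge0 ?p0 //; exact: nn.
- exact: ynp.
have {}zE (w : 'rV[R]_N) : w = z <-> forall i, w 0 i = yn 0 i + dt * \sum_(j < N)
        ((b1 * p i j yn + b2 * p i j y2) * (w 0 j / y2 0 j)
         - (b1 * dest_rate S i j yn + b2 * dest_rate S i j y2) * (w 0 i / y2 0 i)).
  rewrite zE.
  suff e i : \sum_j ((\matrix_(i, j) (dt * (q i j / y2 0 j))) i j * w 0 j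
      - (\matrix_(i, j) (dt * (q i j / y2 0 j))) j i * w 0 i) =
      dt * \sum_(j < N)
        ((b1 * p i j yn + b2 * p i j y2) * (w 0 j / y2 0 j)
         - (b1 * dest_rate S i j yn + b2 * dest_rate S i j y2) * (w 0 i / y2 0 i)).
    by split=> wE i; rewrite {1}wE e.
  rewrite mulr_sumr; apply: eq_bigr => j _.
  by rewrite !mxE (dE _ _ _ (nn _ ynp)) (dE _ _ _ (nn _ y2p)) /q; ring.
exists z; split.
  exists yn, y2; split=> //; first exact/y2E.
  exact/zE.
move=> w [y1 [y2' [/rowP -> h2 h3]]].
by have /y2E y2'E := h2; move: h3; rewrite y2'E => /zE.
Qed.

(* Main.v *)
Require Import Defs.
From mathcomp Require Import all_boot all_order all_algebra.
From mathcomp Require Import all_classical all_reals all_analysis.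
From mathcomp Require Import ring lra.

Import Order.TTheory GRing.Theory Num.Theory.
Import numFieldNormedType.Exports.

Local Open Scope classical_set_scope.
Local Open Scope ring_scope.

(** The proof compares Taylor expansions in the step size [h] at [0^+], the
    starting value [yn] being fixed. Write [F = P - D] for the right-hand side
    of the system.

    The exact solution satisfies
      [y (tn + h) = yn + h F(yn) + h^2 / 2 F'(yn) F(yn) + O(h^3)].
    The expansion is bootstrapped: continuity makes [y' = F(y)] bounded, hence
    [y = yn + O(h)]; then [F(y) = F(yn) + O(h)], hence [y] is known up to
    [O(h^2)]; then the linearization of [F] at [yn] gives [y'] up to [O(h^2)],
    and [y] up to [O(h^3)] ([solution_taylor2]). Only the expansions of the
    rates at the single point [yn] are involved ([C1_Oh], [C2_Oh]); they come
    from the mean value theorem applied to one coordinate after the other.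

    In the scheme both implicit stages are linear systems of the form
    [z = yn + h (...)] with bounded coefficients, so that [z = yn + O(h)]
    ([linear_step_Oh]). Consequently the stage value is
    [y2 = yn + a21 h F(yn) + O(h^2)], and the Patankar weights [ynew / y2] are
    [1 + O(h)], which gives [ynew = yn + h F(yn) + O(h^2)]. For [a21 = 1] the
    stage value and the new value thus agree up to [O(h^2)], and the weights
    are even [1 + O(h^2)]. With such weights the last stage differs by
    [O(h^3)] from the explicit step [yn + h (F(yn) + F(y2)) / 2], whose
    expansion is that of the exact solution ([step_taylor2]).

    Conversely, the linear decay [y_a' = - y_a], [y_b' = y_a] with
    [y_a(0) = 1] has [y_a(h) = exp (- h)], while the scheme yields exactly
    [1 / (1 + h + b1 a21 h^2)] for this constituent ([decay_step]). The coefficients of [h^2]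
    agree only if [b1 a21 = 1 / 2]; adding [b2 a21 = 1 / 2] gives
    [a21 = (b1 + b2) a21 = 1]. *)

(** * Orders of magnitude as the step size tends to zero *)

Definition Oh {R : realType} (k : nat) (e : R -> R) : Prop :=
  e =O_ (0^'+) (fun h : R => h ^+ k).

Lemma OhP {R : realType} (k : nat) (e : R -> R) :
  Oh k e <-> exists2 C, 0 < C & \forall h \near 0^'+, `|e h| <= C * h ^+ k.
Proof.
have pos : \forall h \near (0 : R)^'+, `|h ^+ k| = h ^+ k.
  near=> h; rewrite ger0_norm// exprn_ge0//.
split=> [/eqO_exP[C C0 eC]|[C C0 eC]].
  exists C => //; near=> h.
  have <- : `|h ^+ k| = h ^+ k by near: h.
  by near: h.
apply/eqO_exP; exists C => //; near=> h.
have -> : `|h ^+ k| = h ^+ k by near: h.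
by near: h.
Unshelve. all: by end_near. Qed.

Lemma Oh_near {R : realType} {k : nat} (f : R -> R) {e : R -> R} :
  Oh k f -> (\forall h \near 0^'+, e h = f h) -> Oh k e.
Proof.
move=> /OhP[C C0 fC] ef; apply/OhP; exists C => //.
by near=> h; rewrite (near ef h)//; near: h.
Unshelve. all: by end_near. Qed.

Lemma Oh_ext {R : realType} {k : nat} (f : R -> R) {e : R -> R} :
  Oh k f -> e =1 f -> Oh k e.
Proof. by move=> fk ef; apply: (Oh_near f) => //; apply: nearW. Qed.

Lemma Oh_le {R : realType} {k : nat} (f : R -> R) {e : R -> R} :
  Oh k f -> (\forall h \near 0^'+, `|e h| <= `|f h|) -> Oh k e.
Proof.
move=> /OhP[C C0 fC] ef; apply/OhP; exists C => //.
by near=> h; apply: (le_trans (near ef h _)) => //; near: h.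
Unshelve. all: by end_near. Qed.

Lemma OhD {R : realType} {k : nat} {e f : R -> R} :
  Oh k e -> Oh k f -> Oh k (fun h => e h + f h).
Proof.
move=> /OhP[C C0 eC] /OhP[D D0 fD]; apply/OhP; exists (C + D).
  exact: addr_gt0.
near=> h; apply: (le_trans (ler_normD _ _)); rewrite mulrDl lerD//; by near: h.
Unshelve. all: by end_near. Qed.

Lemma OhN {R : realType} {k : nat} {e : R -> R} :
  Oh k e -> Oh k (fun h => - e h).
Proof. by move=> ek; apply: (Oh_le e) => //; apply: nearW => h; rewrite normrN. Qed.

Lemma OhB {R : realType} {k : nat} {e f : R -> R} :
  Oh k e -> Oh k f -> Oh k (fun h => e h - f h).
Proof. by move=> ek /OhN; exact: OhD. Qed.

Lemma OhM {R : realType} {k l : nat} {e f : R -> R} :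
  Oh k e -> Oh l f -> Oh (k + l) (fun h => e h * f h).
Proof.
move=> /OhP[C C0 eC] /OhP[D D0 fD]; apply/OhP; exists (C * D).
  exact: mulr_gt0.
near=> h; rewrite normrM exprD mulrACA ler_pM//; by near: h.
Unshelve. all: by end_near. Qed.

Lemma Oh_exp {R : realType} (k : nat) : Oh k (fun h : R => h ^+ k).
Proof.
apply/OhP; exists 1 => //; near=> h; rewrite mul1r ger0_norm// exprn_ge0//.
Unshelve. all: by end_near. Qed.

Lemma Oh_cst {R : realType} (c : R) : Oh 0 (fun=> c).
Proof.
apply/OhP; exists (`|c| + 1); first by rewrite ltr_wpDl.
by apply: nearW => h; rewrite expr0 mulr1 lerDl.
Qed.

Lemma Oh_weaken {R : realType} {k l : nat} {e : R -> R} :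
  (l <= k)%N -> Oh k e -> Oh l e.
Proof.
move=> lk /OhP[C C0 eC]; apply/OhP; exists C => //; near=> h.
apply: (@le_trans _ _ (C * h ^+ k)); first by near: h.
rewrite ler_pM2l// ler_wiXn2l//; near: h; exact: nbhs_right_le.
Unshelve. all: by end_near. Qed.

Lemma OhZ {R : realType} {k : nat} (c : R) {e : R -> R} :
  Oh k e -> Oh k (fun h => c * e h).
Proof. by move=> ek; apply: OhM (Oh_cst c) ek. Qed.

Lemma OhX {R : realType} {k : nat} {e : R -> R} :
  Oh k e -> Oh k.+1 (fun h => h * e h).
Proof. by move=> ek; apply: OhM (Oh_exp 1) ek. Qed.

Lemma Oh0 {R : realType} (k : nat) : Oh k (fun=> 0 : R).
Proof.
apply/OhP; exists 1 => //; near=> h; rewrite normr0 mul1r exprn_ge0//.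
Unshelve. all: by end_near. Qed.

Lemma Oh_sum {R : realType} {k N : nat} {e : 'I_N -> R -> R} :
  (forall i, Oh k (e i)) -> Oh k (fun h => \sum_(i < N) e i h).
Proof.
move=> ek; suff H (s : seq 'I_N) : Oh k (fun h => \sum_(i <- s) e i h).
  exact: H.
elim: s => [|i s IH].
  by apply: (Oh_ext (fun=> 0)) (Oh0 k) _ => h; rewrite big_nil.
apply: (Oh_ext (fun h => e i h + \sum_(i <- s) e i h)) (OhD (ek i) IH) _ => h.
by rewrite big_cons.
Qed.

Lemma Oh_norm {R : realType} {k : nat} {e : R -> R} :
  Oh k e -> Oh k (fun h => `|e h|).
Proof. by move=> ek; apply: (Oh_le e) => //; apply: nearW => h; rewrite normr_id. Qed.

Lemma Oh_cvg {R : realType} (c : R) {e : R -> R} :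
  Oh 1 (fun h => e h - c) -> e h @[h --> 0^'+] --> c.
Proof.
move=> /OhP[C C0 eC]; apply/cvgrPdist_le => eps eps0; near=> h.
rewrite distrC; apply: (@le_trans _ _ (C * h ^+ 1)); first by near: h.
rewrite expr1 mulrC -ler_pdivlMr//; near: h.
by apply: nbhs_right_le; exact: divr_gt0.
Unshelve. all: by end_near. Qed.

Lemma cvg_Oh {R : realType} {c : R} {e : R -> R} :
  e h @[h --> 0^'+] --> c -> Oh 0 e.
Proof.
move=> /cvgrPdist_le/(_ _ ltr01) ec; apply: (Oh_le (fun=> `|c| + 1)).
  exact: Oh_cst.
near=> h; rewrite (@ger0_norm _ (`|c| + 1)) ?addr_ge0//.
rewrite -[e h](subrK c) addrC (le_trans (ler_normD _ _))// lerD2l distrC.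
by near: h.
Unshelve. all: by end_near. Qed.

Lemma Oh_inv {R : realType} (c : R) {e : R -> R} : c != 0 ->
  Oh 1 (fun h => e h - c) -> Oh 0 (fun h => (e h)^-1).
Proof. by move=> c0 /Oh_cvg ec; exact: cvg_Oh (cvgV c0 ec). Qed.

Lemma Oh_shift {R : realType} {k : nat} {c : R} {e : R -> R} :
  Oh k (fun h => e h - c) -> Oh 0 e.
Proof.
move=> ek; apply: (Oh_ext (fun h => e h - c + c)); last by move=> h; rewrite subrK.
by apply: OhD (Oh_cst c); apply: Oh_weaken ek.
Qed.

(** Expansions in powers of [h] are unique, in the form that serves to compare a
    single coefficient of two expansions. *)
Lemma Oh_coef0 {R : realType} {k : nat} {c : R} :
  Oh k.+1 (fun h : R => c * h ^+ k) -> c = 0.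
Proof.
move=> /OhP[C C0 cC]; apply/eqP; rewrite -normr_le0.
apply/ler_addgt0Pr => eps eps0; rewrite add0r.
have [h [h0 heps hC]] : exists h, [/\ 0 < h, C * h <= eps &
    `|c * h ^+ k| <= C * h ^+ k.+1].
  near (0 : R)^'+ => h; exists h; split; first by near: h; exact: nbhs_right_gt.
    rewrite mulrC -ler_pdivlMr//; near: h.
    by apply: nbhs_right_le; exact: divr_gt0.
  by near: h.
apply: le_trans heps; rewrite -(@ler_pM2r _ (h ^+ k)) ?exprn_gt0// -mulrA -exprS.
by move: hC; rewrite normrM (@ger0_norm _ (h ^+ k))// exprn_ge0// ltW.
Unshelve. all: by end_near. Qed.

(** * Expansions of functions of several variables at a point *)

(** Turns stages or intermediate points that exist for each small step size
    into functions of the step size, to which [Oh] applies. *)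
Lemma near_choice {T : Type} {V : pointedType} {F : set_system T}
    {FF : Filter F} {Q : T -> V -> Prop} :
  (\forall h \near F, exists v, Q h v) ->
  exists v : T -> V, \forall h \near F, Q h (v h).
Proof.
move=> ex; exists (fun h => xget point (Q h)).
by apply: filterS ex => h [v Qv]; exact: xgetPex (ex_intro _ v Qv).
Qed.

Lemma nbhs_rowP {R : realType} {N : nat} {x : 'rV[R]_N} {P : set 'rV[R]_N} :
  nbhs x P <-> exists2 eps, 0 < eps &
    forall w : 'rV[R]_N, (forall i, `|w 0 i - x 0 i| < eps) -> P w.
Proof.
split.
  move=> /nbhs_ballP[eps eps0 epsP]; exists eps => // w wx; apply: epsP.
  by split=> // i j; rewrite /ball/= (ord1 i) distrC.
move=> [eps eps0 epsP]; apply/nbhs_ballP; exists eps => // w [_ wx].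
by apply: epsP => i; rewrite distrC; exact: wx.
Qed.

(** The points coordinatewise no farther from [x] than [z h] include those that
    arise between [x] and [z h] when coordinates are changed one at a time. *)
Lemma near_row {R : realType} {N : nat} {x : 'rV[R]_N} {z : R -> 'rV[R]_N}
    {P : set 'rV[R]_N} :
  (forall i, Oh 1 (fun h => z h 0 i - x 0 i)) -> nbhs x P ->
  \forall h \near 0^'+, forall w : 'rV[R]_N,
    (forall i, `|w 0 i - x 0 i| <= `|z h 0 i - x 0 i|) -> P w.
Proof.
move=> zx /nbhs_rowP[eps eps0 epsP].
have : \forall h \near 0^'+, forall i, `|z h 0 i - x 0 i| < eps.
  apply: filter_forall => i; have /Oh_cvg/cvgrPdist_lt/(_ _ eps0) := zx i.
  by apply: filterS => h; rewrite distrC.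
apply: filterS => h hz w wz; apply: epsP => i.
exact: le_lt_trans (wz i) (hz i).
Qed.

Lemma Oh_cvg_row {R : realType} {N : nat} {x : 'rV[R]_N} {z : R -> 'rV[R]_N} :
  (forall i, Oh 1 (fun h => z h 0 i - x 0 i)) -> z h @[h --> 0^'+] --> x.
Proof. by move=> zx P /(near_row zx); apply: filterS => h; apply. Qed.

Lemma nbhs_pos_vec {R : realType} {N : nat} {x : 'rV[R]_N} :
  pos_vec x -> \forall w \near x, pos_vec w.
Proof.
move=> x0; apply: (filter_forall (F := nbhs x)) => i.
have /cvgrPdist_lt/(_ _ (x0 i)) near_i : w 0 i @[w --> x] --> x 0 i.
  exact: coord_continuous.
near=> w.
have : `|x 0 i - w 0 i| < x 0 i by near: w; exact: near_i.
by rewrite ltr_norml => /andP[_]; rewrite ltrBlDr ltrDl.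
Unshelve. all: by end_near. Qed.

(** A form of the mean value theorem in which the endpoints come in any order:
    the increment of a coordinate may have either sign. *)
Lemma MVT_dist {R : realType} {f df : R -> R} {a b : R} :
  (forall x, `|x - a| <= `|b - a| -> is_derive x 1 f (df x)) ->
  exists2 c, `|c - a| <= `|b - a| & f b - f a = df c * (b - a).
Proof.
move=> fdf; case: (leP a b) => ab.
  have ba : `|b - a| = b - a by rewrite ger0_norm// subr_ge0.
  have inab x : x \in `[a, b] -> `|x - a| <= `|b - a|.
    by rewrite in_itv/= => /andP[ax xb]; rewrite ba ger0_norm ?subr_ge0// lerD2r.
  have [||c cab fE] := @MVT_segment R f df a b ab.
  - move=> x xab; apply/fdf/inab.
    by move: xab; rewrite !in_itv/= => /andP[/ltW -> /ltW ->].
  - by apply: derivable_within_continuous => x xab; have [] := fdf x (inab x xab).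
  by exists c => //; exact: inab.
have ba : `|b - a| = a - b by rewrite ltr0_norm ?opprB// subr_lt0.
have inab x : x \in `[b, a] -> `|x - a| <= `|b - a|.
  rewrite in_itv/= => /andP[bx xa].
  by rewrite ba ler0_norm ?subr_le0// opprB lerD2l lerN2.
have [||c cab fE] := @MVT_segment R f df b a (ltW ab).
- move=> x xab; apply/fdf/inab.
  by move: xab; rewrite !in_itv/= => /andP[/ltW -> /ltW ->].
- by apply: derivable_within_continuous => x xab; have [] := fdf x (inab x xab).
by exists c; [exact: inab|rewrite -opprB fE -mulrN opprB].
Qed.

Lemma is_derive_line {R : realType} {N : nat} {f : 'rV[R]_N -> R}
    {w v : 'rV[R]_N} {s : R} :
  derivable f (w + s *: v) v ->
  is_derive s 1 (fun t => f (w + t *: v)) ('D_v f (w + s *: v)).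
Proof.
move=> fd.
suff E : (fun h : R => h^-1 *: (((fun t => f (w + t *: v)) \o shift s) (h *: 1)
    - f (w + s *: v))) =
  (fun h : R => h^-1 *: ((f \o shift (w + s *: v)) (h *: v) - f (w + s *: v))).
  by split; rewrite /derivable /derive E.
apply/funext => h /=; congr (_ *: (f _ - _)).
by rewrite scaler1 scalerDl addrCA.
Qed.

(** Passing from [x] to [y] by changing one coordinate at a time, the mean value
    theorem applies to each change and brings in one partial derivative. *)
Lemma coord_MVT {R : realType} {N : nat} {f : 'rV[R]_N -> R} {x y : 'rV[R]_N} :
  (forall w : 'rV[R]_N, (forall i, `|w 0 i - x 0 i| <= `|y 0 i - x 0 i|) ->
    forall j, derivable f w (delta_mx 0 j)) ->
  exists2 xi : 'I_N -> 'rV[R]_N,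
    forall k i, `|xi k 0 i - x 0 i| <= `|y 0 i - x 0 i| &
    f y - f x = \sum_(k < N) 'D_(delta_mx 0 k) f (xi k) * (y 0 k - x 0 k).
Proof.
move=> fd.
(* z m has the first m coordinates of y and the others of x. *)
pose z (m : nat) : 'rV[R]_N := \row_i (if (i < m)%N then y 0 i else x 0 i).
have zS (k : 'I_N) : z k.+1 = z k + (y 0 k - x 0 k) *: delta_mx 0 k.
  apply/rowP => i; rewrite !mxE eqxx/= ltnS leq_eqVlt.
  case: (eqVneq i k) => [->|ik]; first by rewrite eqxx ltnn /= mulr1 addrC subrK.
  by rewrite (negbTE ik : (nat_of_ord i == k) = false) /= mulr0 addr0.
have : forall k : 'I_N, exists w : 'rV[R]_N,
    (forall i, `|w 0 i - x 0 i| <= `|y 0 i - x 0 i|) /\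
    f (z k.+1) - f (z k) = 'D_(delta_mx 0 k) f w * (y 0 k - x 0 k).
  move=> k; pose w (s : R) := z k + s *: delta_mx 0 k.
  have wy s : `|s - 0| <= `|y 0 k - x 0 k - 0| ->
      forall i, `|w s 0 i - x 0 i| <= `|y 0 i - x 0 i|.
    rewrite !subr0 => sy i; rewrite !mxE eqxx/=.
    case: (eqVneq i k) => [->|ik].
      by rewrite ltnn mulr1 addrAC subrr add0r.
    by rewrite mulr0 addr0; case: ifP => // _; rewrite subrr normr0.
  have [|s sy fE] := @MVT_dist R (f \o w) (fun s => 'D_(delta_mx 0 k) f (w s))
      0 (y 0 k - x 0 k).
    by move=> s sy; apply: is_derive_line; apply: fd; exact: wy.
  exists (w s); split; first exact: wy.
  by rewrite zS; move: fE; rewrite /= subr0 /w scale0r addr0.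
move=> /choice[xi xiP]; exists xi; first by move=> k; have [] := xiP k.
under eq_bigr => k _ do rewrite -(xiP k).2.
rewrite -(big_mkord xpredT (fun k => f (z k.+1) - f (z k))) telescope_sumr//.
by congr (f _ - f _); apply/rowP => i; rewrite mxE ?ltn_ord.
Qed.

Lemma coord_MVT_near {R : realType} {N : nat} {U : set 'rV[R]_N}
    {f : 'rV[R]_N -> R} {x : 'rV[R]_N} {z : R -> 'rV[R]_N} :
  nbhs x U -> (forall j y, U y -> derivable f y (delta_mx 0 j)) ->
  (forall i, Oh 1 (fun h => z h 0 i - x 0 i)) ->
  exists2 xi : 'I_N -> R -> 'rV[R]_N,
    forall k i, Oh 1 (fun h => xi k h 0 i - x 0 i) &
    \forall h \near 0^'+, f (z h) - f x =
      \sum_(k < N) 'D_(delta_mx 0 k) f (xi k h) * (z h 0 k - x 0 k).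
Proof.
move=> Ux fd zx.
have /near_choice[xi xiP] : \forall h \near 0^'+, exists xi : 'I_N -> 'rV[R]_N,
    (forall k i, `|xi k 0 i - x 0 i| <= `|z h 0 i - x 0 i|) /\
    f (z h) - f x =
      \sum_(k < N) 'D_(delta_mx 0 k) f (xi k) * (z h 0 k - x 0 k).
  apply: filterS (near_row zx Ux) => h hU.
  have [|xi xiz fE] := @coord_MVT R N f x (z h); last by exists xi.
  by move=> w /hU Uw j; exact: fd.
exists (fun k h => xi h k) => [k i|]; last by apply: filterS xiP => h [].
by apply: (Oh_le (fun h => z h 0 i - x 0 i)) => //; apply: filterS xiP => h [].
Qed.

(** The partial derivatives at the intermediate points are bounded because
    they converge to those at [x]. *)
Lemma C1_Oh {R : realType} {N : nat} {U : set 'rV[R]_N} {f : 'rV[R]_N -> R}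
    {x : 'rV[R]_N} {z : R -> 'rV[R]_N} :
  nbhs x U -> Ck_on U 1 f -> (forall i, Oh 1 (fun h => z h 0 i - x 0 i)) ->
  Oh 1 (fun h => f (z h) - f x).
Proof.
move=> Ux [_ fC] zx.
have [|xi xix fE] := coord_MVT_near (f := f) Ux _ zx.
  by move=> j; exact: (fC j).1.
apply: Oh_near fE; apply: Oh_sum => k; apply: (OhM (k := 0)) => //.
apply: (@cvg_Oh _ ('D_(delta_mx 0 k) f x)).
have cont := (fC k).2.1 x (nbhs_singleton Ux).
exact: cvg_comp (Oh_cvg_row (xix k)) cont.
Qed.

(** The partial derivatives being of class C1, their values at the intermediate
    points are those at [x] up to order 1, and they multiply increments of
    order 1. *)
Lemma C2_Oh {R : realType} {N : nat} {U : set 'rV[R]_N} {f : 'rV[R]_N -> R}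
    {x : 'rV[R]_N} {z : R -> 'rV[R]_N} :
  nbhs x U -> Ck_on U 2 f -> (forall i, Oh 1 (fun h => z h 0 i - x 0 i)) ->
  Oh 2 (fun h => f (z h) - f x -
    \sum_(k < N) 'D_(delta_mx 0 k) f x * (z h 0 k - x 0 k)).
Proof.
move=> Ux [_ fC] zx.
have [|xi xix fE] := coord_MVT_near (f := f) Ux _ zx.
  by move=> j; exact: (fC j).1.
apply: (Oh_near (fun h => \sum_(k < N)
  ('D_(delta_mx 0 k) f (xi k h) - 'D_(delta_mx 0 k) f x) * (z h 0 k - x 0 k))).
  apply: Oh_sum => k; apply: (OhM (k := 1)) => //.
  exact: C1_Oh Ux (fC k).2 (xix k).
apply: filterS fE => h ->; rewrite -sumrB; apply: eq_bigr => k _.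
by rewrite mulrBl.
Qed.

(** * Integration of expansions *)

(** At the left endpoint a solution of the system is only continuous, from the
    right. *)
Lemma MVT_right {R : realType} {u du : R -> R} {a b : R} :
  a < b -> u x @[x --> a^'+] --> u a ->
  (forall x, a < x -> is_derive x 1 u (du x)) ->
  exists2 c, a < c < b & u b - u a = du c * (b - a).
Proof.
move=> ab ua udu.
have uC x : a < x -> u y @[y --> x] --> u x.
  move=> /udu[+ _] => /derivable1_diffP; exact: differentiable_continuous.
have [|| c cab uE] := @MVT R u du a b ab.
- by move=> x; rewrite in_itv/= => /andP[ax _]; exact: udu.
- apply/continuous_within_itvP => //; split => //.
    by move=> x; rewrite in_itv/= => /andP[ax _]; exact: uC.
  by apply: cvg_at_left_filter; exact: uC.
by exists c => //; move: cab; rewrite in_itv.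
Qed.

(** Apply the mean value theorem to [u] minus the primitive of [c0 + c1 h]: the
    remainder is a value of the remainder of [du] before [h], times [h]. *)
Lemma Oh_primitive {R : realType} {k : nat} {u du : R -> R} {a : R} (c0 c1 : R) :
  u x @[x --> a^'+] --> u a ->
  (forall x, a < x -> is_derive x 1 u (du x)) ->
  Oh k (fun h => du (a + h) - (c0 + c1 * h)) ->
  Oh k.+1 (fun h => u (a + h) - (u a + c0 * h + c1 / 2 * h ^+ 2)).
Proof.
move=> ua udu /OhP[C C0]; rewrite near_withinE => /nbhs_ballP[eps /= eps0 duC].
apply/OhP; exists C => //; near=> h.
have h0 : 0 < h by [].
pose v x := u x - (c0 * (x - a) + c1 / 2 * (x - a) ^+ 2).
pose dv x := du x - (c0 + c1 * (x - a)).
have vdv x : a < x -> is_derive x 1 v (dv x).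
  move=> ax; have ? := udu x ax; apply: is_derive_eq; rewrite /dv.
  by rewrite /GRing.scale/=; field.
have va : v x @[x --> a^'+] --> v a.
  apply: cvgB => //; apply: cvg_at_right_filter.
  by apply: cvgD; apply: cvgM; (try exact: cvg_cst);
    [|apply: cvgM]; apply: cvgB; (try exact: cvg_cst); exact: cvg_id.
have [|c /andP[ac ch] vE] := MVT_right (b := a + h) _ va vdv; first lra.
have -> : u (a + h) - (u a + c0 * h + c1 / 2 * h ^+ 2) = dv c * h.
  by rewrite -[X in dv c * X](addrK a) (addrC h) -vE /v; field.
rewrite normrM (ger0_norm (ltW h0)) exprSr mulrA ler_pM2r//.
have heps : h < eps by near: h; exact: nbhs_right_lt.
apply: (@le_trans _ _ (C * (c - a) ^+ k)); last first.
  by rewrite ler_pM2l// lerXn2r ?nnegrE//; lra.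
have := duC (c - a); rewrite /ball/= sub0r normrN (addrC a) subrK /dv; apply.
  by rewrite gtr0_norm; lra.
by rewrite subr_gt0.
Unshelve. all: by end_near. Qed.

(** * The right-hand side along a curve leaving the starting value *)

Definition rhs {R : realType} {N : nat} (S : pds R N) (i : 'I_N)
  (y : 'rV[R]_N) : R := prod_term S i y - dest_term S i y.

Definition rhs_partial {R : realType} {N : nat} (S : pds R N) (i k : 'I_N)
    (y : 'rV[R]_N) : R :=
  \sum_(j < N) ('D_(delta_mx 0 k) (prod_rate S i j) y -
                'D_(delta_mx 0 k) (dest_rate S i j) y).

(** The Taylor polynomial of degree 2 of the solution through [yn]:
    [y' = F(y)] implies [y'' = F'(y) F(y)]. *)
Definition taylor2 {R : realType} {N : nat} (S : pds R N) (i : 'I_N)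
    (yn : 'rV[R]_N) (h : R) : R :=
  yn 0 i + rhs S i yn * h +
  (\sum_(k < N) rhs_partial S i k yn * rhs S k yn) / 2 * h ^+ 2.

Section Rates.
Context {R : realType} {N : nat} {S : pds R N} {yn : 'rV[R]_N}.
Hypothesis yn0 : pos_vec yn.
Context {z : R -> 'rV[R]_N}.
Hypothesis zyn : forall i, Oh 1 (fun h => z h 0 i - yn 0 i).

Lemma C2_C1 {U : set 'rV[R]_N} {f : 'rV[R]_N -> R} : Ck_on U 2 f -> Ck_on U 1 f.
Proof. by move=> [fC fD]; split=> // j; have [? []] := fD j. Qed.

Lemma prod_rate_Oh i j : Oh 1 (fun h => prod_rate S i j (z h) - prod_rate S i j yn).
Proof. exact: C1_Oh (nbhs_pos_vec yn0) (C2_C1 (prod_rate_C2 S i j)) zyn. Qed.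

Lemma dest_rate_Oh i j : Oh 1 (fun h => dest_rate S i j (z h) - dest_rate S i j yn).
Proof. exact: C1_Oh (nbhs_pos_vec yn0) (C2_C1 (dest_rate_C2 S i j)) zyn. Qed.

Lemma rhs_sum i y : rhs S i y = \sum_(j < N) (prod_rate S i j y - dest_rate S i j y).
Proof. by rewrite sumrB. Qed.

Lemma rhs_Oh i : Oh 1 (fun h => rhs S i (z h) - rhs S i yn).
Proof.
apply: (Oh_ext (fun h => \sum_(j < N) ((prod_rate S i j (z h) - prod_rate S i j yn) -
   (dest_rate S i j (z h) - dest_rate S i j yn)))).
  by apply: Oh_sum => j; apply: OhB; [exact: prod_rate_Oh|exact: dest_rate_Oh].
by move=> h; rewrite !rhs_sum -sumrB; apply: eq_bigr => j _; ring.
Qed.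

Lemma rhs_linearize i : Oh 2 (fun h => rhs S i (z h) - rhs S i yn -
  \sum_(k < N) rhs_partial S i k yn * (z h 0 k - yn 0 k)).
Proof.
pose lin (f : 'rV[R]_N -> R) (h : R) : R := f (z h) - f yn -
  \sum_(k < N) 'D_(delta_mx 0 k) f yn * (z h 0 k - yn 0 k).
apply: (Oh_ext (fun h => \sum_(j < N) (lin (prod_rate S i j) h -
    lin (dest_rate S i j) h))).
  by apply: Oh_sum => j; apply: OhB; apply: C2_Oh zyn;
    (try exact: nbhs_pos_vec); [exact: prod_rate_C2|exact: dest_rate_C2].
move=> h; rewrite !rhs_sum -sumrB.
under [X in _ - X = _]eq_bigr => k _ do rewrite mulr_suml.
rewrite exchange_big -sumrB; apply: eq_bigr => j _; rewrite /lin.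
under eq_bigr => k _ do rewrite mulrBl.
by rewrite sumrB; ring.
Qed.

(** Along any curve that leaves [yn] with velocity [rhs S yn], whether the exact
    solution or a stage of the scheme, the right-hand side has the same
    first-order expansion. *)
Lemma rhs_along i : (forall k, Oh 2 (fun h => z h 0 k - (yn 0 k + rhs S k yn * h))) ->
  Oh 2 (fun h => rhs S i (z h) -
    (rhs S i yn + (\sum_(k < N) rhs_partial S i k yn * rhs S k yn) * h)).
Proof.
move=> z2; pose e h := \sum_(k < N) rhs_partial S i k yn *
  (z h 0 k - (yn 0 k + rhs S k yn * h)).
have e2 : Oh 2 e by apply: Oh_sum => k; exact: OhZ.
apply: (Oh_ext _ (OhD (rhs_linearize i) e2)) => h.
have -> : (\sum_(k < N) rhs_partial S i k yn * rhs S k yn) * h =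
    \sum_(k < N) rhs_partial S i k yn * (z h 0 k - yn 0 k) - e h.
  by rewrite mulr_suml -sumrB; apply: eq_bigr => k _; ring.
ring.
Qed.

End Rates.

(** * Expansion of the exact solution *)

(** Bootstrap: each expansion of the solution gives one for the right-hand side
    along it, whose primitive is the next expansion of the solution. *)
Lemma solution_taylor2 {R : realType} {N : nat} {S : pds R N} {tn : R}
    {yn : 'rV[R]_N} {y : R -> 'rV[R]_N} (i : 'I_N) :
  pos_vec yn -> pds_solution S tn yn y ->
  Oh 3 (fun h => y (tn + h) 0 i - taylor2 S i yn h).
Proof.
move=> yn0 [ytn _ /continuous_within_itvcyP[_ ycont] yder].
pose z h := y (tn + h).
have cvg_i j : y x 0 j @[x --> tn^'+] --> y tn 0 j.
  have coordC : w 0 j @[w --> y tn] --> y tn 0 j by exact: coord_continuous.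
  exact: cvg_comp ycont coordC.
have primitive k c0 c1 j := @Oh_primitive R k (fun s => y s 0 j)
  (fun s => rhs S j (y s)) tn c0 c1 (cvg_i j) (fun t tnt => yder t tnt j).
have zcvg : z h @[h --> 0^'+] --> yn.
  by rewrite -ytn => P /ycont /nbhs_right0P.
have z0 j : Oh 0 (fun h => rhs S j (z h) - (0 + 0 * h)).
  apply: (Oh_ext (fun h => rhs S j (z h))); last by move=> h; ring.
  have cvg_f (f : 'rV[R]_N -> R) : Ck_on pos_vec 2 f -> Oh 0 (fun h => f (z h)).
    move=> [fC _]; have f_yn : f w @[w --> yn] --> f yn by exact: fC.
    exact: cvg_Oh (cvg_comp z f zcvg f_yn).
  by apply: OhB; apply: Oh_sum => l; apply: cvg_f;
    [exact: prod_rate_C2|exact: dest_rate_C2].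
have z1 j : Oh 1 (fun h => z h 0 j - yn 0 j).
  apply: (Oh_ext _ (primitive _ _ _ j (z0 j))) => h.
  by rewrite /z ytn; field.
have z2 j : Oh 2 (fun h => z h 0 j - (yn 0 j + rhs S j yn * h)).
  have h1 : Oh 1 (fun h => rhs S j (z h) - (rhs S j yn + 0 * h)).
    by apply: (Oh_ext _ (rhs_Oh yn0 z1 j)) => h; rewrite mul0r addr0.
  apply: (Oh_ext _ (primitive _ _ _ j h1)) => h.
  by rewrite /z ytn; field.
apply: (Oh_ext _ (primitive _ _ _ i (rhs_along yn0 z1 i z2))) => h.
by rewrite ytn.
Qed.

(** * Expansion of the scheme *)

(** With [m] the sum of the [`|z i|], the equations bound [m] by the sum of the
    [`|x i|] plus [h * K * (1 + m)], and the term in [m] can be absorbed when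
    [h * K] is at most [1 / 2]. *)
Lemma linear_step_bounded {R : realType} {N : nat} {x z : 'I_N -> R}
    {A : 'I_N -> R} {B C : 'I_N -> 'I_N -> R} {h K : R} :
  0 <= h -> h * K <= 1 / 2 ->
  \sum_i (`|A i| + \sum_j (`|B i j| + `|C i j|)) <= K ->
  (forall i, z i = x i + h * (A i + \sum_j (B i j * z j - C i j * z i))) ->
  \sum_i `|z i| <= 2 * \sum_i `|x i| + 1.
Proof.
move=> h0 hK ABC zE; set m := \sum_i `|z i|.
have zm i : `|z i| <= m by rewrite /m (bigD1 i)//= lerDl sumr_ge0.
have m0 : 0 <= m by exact: sumr_ge0.
suff : m <= \sum_i `|x i| + h * K * (1 + m).
  have := ler_wpM2r (_ : 0 <= 1 + m) hK; lra.
rewrite {1}/m (eq_bigr _ (fun i _ => congr1 Num.norm (zE i))).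
apply: (@le_trans _ _ (\sum_i (`|x i| + h * (1 + m) *
    (`|A i| + \sum_j (`|B i j| + `|C i j|))))).
  apply: ler_sum => i _; apply: (le_trans (ler_normD _ _)); rewrite lerD2l.
  rewrite normrM ger0_norm// -mulrA ler_wpM2l//.
  apply: (le_trans (ler_normD _ _)); rewrite mulrDr; apply: lerD.
    by rewrite ler_peMl// lerDl.
  apply: (le_trans (ler_norm_sum _ _ _)); rewrite mulr_sumr.
  apply: ler_sum => j _; apply: (le_trans (ler_normB _ _)).
  rewrite !normrM mulrDr ![(1 + m) * _]mulrC.
  by apply: lerD; rewrite ler_wpM2l// (le_trans (zm _))// lerDr.
rewrite big_split/= -mulr_sumr lerD2l [h * K * _]mulrAC.
by rewrite ler_wpM2l// mulr_ge0// addr_ge0.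
Qed.

(** The common form of both implicit stages; boundedness of [z] comes first,
    and the equations then show that it is within order 1 of [x]. *)
Lemma linear_step_Oh {R : realType} {N : nat} {x : 'rV[R]_N}
    {A : 'I_N -> R -> R} {B C : 'I_N -> 'I_N -> R -> R} {z : R -> 'rV[R]_N} :
  (forall i, Oh 0 (A i)) -> (forall i j, Oh 0 (B i j)) ->
  (forall i j, Oh 0 (C i j)) ->
  (\forall h \near 0^'+, forall i, z h 0 i = x 0 i +
    h * (A i h + \sum_j (B i j h * z h 0 j - C i j h * z h 0 i))) ->
  forall i, Oh 1 (fun h => z h 0 i - x 0 i).
Proof.
move=> A0 B0 C0 zE.
have z0 i : Oh 0 (fun h => z h 0 i).
  have /OhP[K K0 ABC] : Oh 0 (fun h =>
      \sum_i (`|A i h| + \sum_j (`|B i j h| + `|C i j h|))).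
    apply: Oh_sum => j; apply: OhD; first exact: Oh_norm.
    by apply: Oh_sum => l; apply: OhD; exact: Oh_norm.
  apply: (Oh_le (fun=> 2 * \sum_i `|x 0 i| + 1)); first exact: Oh_cst.
  near=> h; apply: le_trans (ler_norm _).
  apply: (@le_trans _ _ (\sum_i `|z h 0 i|)).
    by rewrite (bigD1 i)//= lerDl sumr_ge0.
  apply: (@linear_step_bounded _ _ _ _ (A^~ h) (fun i j => B i j h)
    (fun i j => C i j h) h K) => //.
  - rewrite -ler_pdivlMr//; near: h; apply: nbhs_right_le.
    by rewrite !divr_gt0.
  - have : `|\sum_i (`|A i h| + \sum_j (`|B i j h| + `|C i j h|))| <= K * h ^+ 0.
      by near: h.
    by rewrite expr0 mulr1 => ?; apply: le_trans (ler_norm _) _.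
  - by near: h.
move=> i; apply: (Oh_near (fun h => h *
  (A i h + \sum_j (B i j h * z h 0 j - C i j h * z h 0 i)))).
  apply: OhX; apply: OhD => //; apply: Oh_sum => j.
  by apply: OhB; apply: (OhM (k := 0) (l := 0)).
by apply: filterS zE => h hE; rewrite {1}hE addrC addKr.
Unshelve. all: by end_near. Qed.

Lemma Oh_ratio {R : realType} {k : nat} {c : R} {w z : R -> R} : c != 0 ->
  Oh 1 (fun h => z h - c) -> Oh k (fun h => w h - z h) ->
  Oh k (fun h => w h / z h - 1).
Proof.
move=> c0 zc wz; apply: (Oh_near (fun h => (w h - z h) / z h)).
  by rewrite -[k]addn0; apply: OhM wz _; exact: Oh_inv c0 zc.
have zn0 : \forall h \near 0^'+, z h != 0 by exact: cvgr_neq0 (Oh_cvg _ zc) c0.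
by apply: filterS zn0 => h z0; rewrite mulrBl divff.
Qed.

Section Scheme.
Context {R : realType} {N : nat} {S : pds R N} {yn : 'rV[R]_N}.
Hypothesis yn0 : pos_vec yn.
Context {delta a21 b1 b2 : R} {y2 ynew : R -> 'rV[R]_N}.
Hypothesis scheme : \forall h \near 0^'+,
  mprk_eqs delta a21 b1 b2 S yn (y2 h) h yn yn (y2 h) (ynew h).

Let yn_neq0 i : yn 0 i != 0. Proof. by rewrite gt_eqF. Qed.

Lemma stage_Oh i : Oh 1 (fun h => y2 h 0 i - yn 0 i).
Proof.
apply: (linear_step_Oh (A := fun i _ => a21 *
    \sum_(j < N) prod_rate S i j yn * (1 - delta))
  (B := fun i j _ => a21 * (prod_rate S i j yn / yn 0 j * delta))
  (C := fun i j _ => a21 * (dest_rate S i j yn / yn 0 i))) i => *;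
  try exact: Oh_cst.
apply: filterS scheme => h [_ y2E _] i; rewrite {1}y2E; congr (_ + _).
rewrite !mulr_sumr -big_split/= mulr_sumr; apply: eq_bigr => j _; ring.
Qed.

(** Replacing the weights [y2 / yn], which are 1 up to order 1, by 1 leaves the
    explicit Euler step of length [a21 * h], whatever [delta] is. *)
Lemma stage_expansion i :
  Oh 2 (fun h => y2 h 0 i - (yn 0 i + a21 * rhs S i yn * h)).
Proof.
pose r i h := y2 h 0 i / yn 0 i - 1.
have r1 j : Oh 1 (r j).
  apply: (Oh_ext (fun h => (yn 0 j)^-1 * (y2 h 0 j - yn 0 j))).
    by apply: OhZ; exact: stage_Oh.
  by move=> h; rewrite /r; field; exact: yn_neq0.
apply: (Oh_near (fun h => h * (a21 * \sum_(j < N)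
    (prod_rate S i j yn * delta * r j h - dest_rate S i j yn * r i h)))).
  apply/OhX/OhZ/Oh_sum => j; apply: OhB; exact: OhZ.
apply: filterS scheme => h [_ y2E _]; rewrite {1}y2E rhs_sum.
rewrite !mulr_sumr mulr_suml opprD addrACA subrr add0r -sumrB.
by apply: eq_bigr => j _; rewrite /r; ring.
Qed.

Let Q i j h := b1 * prod_rate S i j yn + b2 * prod_rate S i j (y2 h).
Let E i j h := b1 * dest_rate S i j yn + b2 * dest_rate S i j (y2 h).

Let Q0 i j : Oh 0 (Q i j).
Proof.
apply: OhD; first exact: Oh_cst.
by apply: OhZ; apply: Oh_shift (prod_rate_Oh yn0 stage_Oh i j).
Qed.

Let E0 i j : Oh 0 (E i j).
Proof.
apply: OhD; first exact: Oh_cst.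
by apply: OhZ; apply: Oh_shift (dest_rate_Oh yn0 stage_Oh i j).
Qed.

Lemma step_Oh i : Oh 1 (fun h => ynew h 0 i - yn 0 i).
Proof.
apply: (linear_step_Oh (A := fun i _ => 0)
  (B := fun i j h => Q i j h * (y2 h 0 j)^-1)
  (C := fun i j h => E i j h * (y2 h 0 i)^-1)) i => [i|i j|i j|].
- exact: Oh_cst.
- by apply: (OhM (k := 0) (l := 0)) => //; exact: Oh_inv (yn_neq0 j) (stage_Oh j).
- by apply: (OhM (k := 0) (l := 0)) => //; exact: Oh_inv (yn_neq0 i) (stage_Oh i).
apply: filterS scheme => h [_ _ ynewE] i; rewrite {1}ynewE add0r.
congr (_ + _ * _); apply: eq_bigr => j _; rewrite /Q /E; ring.
Qed.

(** The weights [ynew / y2] appear multiplied by [h], so replacing them by 1 gains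
    one order over the distance of [ynew] to [y2]; what remains is the last
    stage of the explicit scheme. *)
Lemma step_weights k i : (forall j, Oh k (fun h => ynew h 0 j - y2 h 0 j)) ->
  Oh k.+1 (fun h => ynew h 0 i -
    (yn 0 i + h * (b1 * rhs S i yn + b2 * rhs S i (y2 h)))).
Proof.
move=> wk; pose r j h := ynew h 0 j / y2 h 0 j - 1.
have rk j : Oh k (r j) by apply: Oh_ratio (yn_neq0 j) (stage_Oh j) (wk j).
apply: (Oh_near (fun h => h * \sum_(j < N) (Q i j h * r j h - E i j h * r i h))).
  by apply/OhX/Oh_sum => j; apply: OhB; apply: (OhM (k := 0)).
apply: filterS scheme => h [_ _ ynewE]; rewrite {1}ynewE !rhs_sum.
rewrite opprD addrACA subrr add0r -mulrBr; congr (_ * _).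
rewrite !mulr_sumr -big_split/= -sumrB.
by apply: eq_bigr => j _; rewrite /r /Q /E; ring.
Qed.

(** [step_weights] is used twice: first with the crude distance of order 1 from
    [ynew] to [y2], which shows that both have the expansion of the Euler step
    since [a21 = 1], and then with the resulting distance of order 2. *)
Lemma step_taylor2 : a21 = 1 -> b1 = 1 / 2 -> b2 = 1 / 2 ->
  forall i, Oh 3 (fun h => ynew h 0 i - taylor2 S i yn h).
Proof.
move=> a1 b1h b2h.
have y2_2 j : Oh 2 (fun h => y2 h 0 j - (yn 0 j + rhs S j yn * h)).
  by apply: (Oh_ext _ (stage_expansion j)) => h; rewrite a1 mul1r.
have w1 j : Oh 1 (fun h => ynew h 0 j - y2 h 0 j).
  by apply: (Oh_ext _ (OhB (step_Oh j) (stage_Oh j))) => h; ring.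
have w2 j : Oh 2 (fun h => ynew h 0 j - y2 h 0 j).
  have F1 : Oh 2 (fun h => h * (b2 * (rhs S j (y2 h) - rhs S j yn))).
    by apply/OhX/OhZ; exact: (rhs_Oh (z := y2) yn0 stage_Oh j).
  apply: (Oh_ext _ (OhB (OhD (step_weights 1 j w1) F1) (y2_2 j))) => h.
  by rewrite b1h b2h; field.
move=> i.
have F2 := OhX (OhZ b2 (rhs_along yn0 stage_Oh i y2_2)).
apply: (Oh_ext _ (OhD (step_weights 2 i w2) F2)) => h.
by rewrite /taylor2 b1h b2h; field.
Qed.

End Scheme.

(** * Linear decay from one constituent to another *)

Lemma is_derive_coord {R : realType} {N : nat} (v y : 'rV[R]_N) (a : 'I_N) :
  is_derive y v (fun w : 'rV[R]_N => w 0 a) (v 0 a).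
Proof.
have lim_v : h^-1 *: (((fun w : 'rV[R]_N => w 0 a) \o shift y) (h *: v) - y 0 a)
    @[h --> (0 : R)^'] --> v 0 a.
  apply: cvg_near_cst.
  near=> h; have h0 : h != 0 by near: h; exact: nbhs_dnbhs_neq.
  by rewrite /= !mxE addrK /GRing.scale/= mulKf.
by split; [exact: cvgP lim_v|exact: cvg_lim lim_v].
Unshelve. all: by end_near. Qed.

Lemma Ck_on_cst {R : realType} {N : nat} (U : set 'rV[R]_N) (k : nat) (c : R) :
  Ck_on U k (fun=> c).
Proof.
elim: k c => [|k IH] c; split=> //; try by move=> y _; exact: cst_continuous.
move=> j; split; first by move=> y _; exact: derivable_cst.
have -> : (fun y : 'rV[R]_N => 'D_(delta_mx 0 j) (fun=> c) y) = (fun=> 0).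
  by apply/funext => y; exact: derive_cst.
exact: IH.
Qed.

Lemma Ck_on_coord {R : realType} {N : nat} (U : set 'rV[R]_N) (k : nat) (a : 'I_N) :
  Ck_on U k (fun y => y 0 a).
Proof.
case: k => [|k]; split=> //; try by move=> y _; exact: coord_continuous.
move=> j; split; first by move=> y _; have [] := is_derive_coord (delta_mx 0 j) y a.
have -> : (fun y : 'rV[R]_N => 'D_(delta_mx 0 j) (fun y : 'rV[R]_N => y 0 a) y) =
    (fun=> (delta_mx 0 j : 'rV[R]_N) 0 a).
  by apply/funext => y; have [] := is_derive_coord (delta_mx 0 j) y a.
exact: Ck_on_cst.
Qed.

Section Decay.
Context {R : realType} {N : nat} (a b : 'I_N).
Hypothesis ab : a != b.

Definition decay_rate (i j : 'I_N) (y : 'rV[R]_N) : R :=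
  if (i == a) && (j == b) then y 0 a else 0.

Lemma decay_rate_ge0 i j y : nonneg_vec y -> 0 <= decay_rate i j y.
Proof. by move=> y0; rewrite /decay_rate; case: ifP. Qed.

Lemma decay_rate_C2 i j : Ck_on pos_vec 2 (decay_rate i j).
Proof.
rewrite /decay_rate; case: ((i == a) && (j == b)).
  exact: Ck_on_coord.
exact: Ck_on_cst.
Qed.

Definition decay : pds R N :=
  Pds (fun i j => decay_rate_ge0 j i) decay_rate_ge0
      (fun i j => decay_rate_C2 j i) decay_rate_C2.

Lemma decay_conservative : fully_conservative decay.
Proof.
move=> y _; split=> // i /=; rewrite /decay_rate.
by case: eqVneq => // ->; rewrite (negbTE ab).
Qed.

Lemma decay_rhs i y : prod_term decay i y - dest_term decay i y =
  ((i == b)%:R - (i == a)%:R) * y 0 a.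
Proof.
rewrite mulrBl; congr (_ - _).
  rewrite /prod_term /= (bigD1 a)//= /decay_rate eqxx/= big1 => [|j ja].
    by rewrite addr0; case: ifP => _; rewrite ?mul1r ?mul0r.
  by rewrite (negbTE ja).
rewrite /dest_term /= (bigD1 b)//= /decay_rate eqxx/= big1 => [|j jb].
  by rewrite addr0 andbT; case: ifP => _; rewrite ?mul1r ?mul0r.
by rewrite (negbTE jb) andbF.
Qed.

Definition decay_flow (y0 : 'rV[R]_N) (t : R) : 'rV[R]_N :=
  y0 + (1 - expR (- t)) *: (y0 0 a *: (delta_mx 0 b - delta_mx 0 a)).

Lemma decay_flowE y0 t i : decay_flow y0 t 0 i =
  y0 0 i + (1 - expR (- t)) * (y0 0 a * ((i == b)%:R - (i == a)%:R)).
Proof. by rewrite !mxE. Qed.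

Lemma decay_flow_source y0 t : decay_flow y0 t 0 a = y0 0 a * expR (- t).
Proof. by rewrite decay_flowE eqxx (negbTE ab)/=; ring. Qed.

Lemma decay_flow_solution y0 : pos_vec y0 -> pds_solution decay 0 y0 (decay_flow y0).
Proof.
move=> y00; split.
- by rewrite /decay_flow oppr0 expR0 subrr scale0r addr0.
- move=> t t0 i; case: (eqVneq i a) => [->|ia].
    by rewrite decay_flow_source mulr_ge0 ?expR_ge0// ltW.
  rewrite decay_flowE (negbTE ia) subr0 addr_ge0 ?mulr_ge0 ?ler0n//; try exact: ltW.
  by rewrite subr_ge0 -expR0 ler_expR oppr_le0.
- apply: continuous_subspaceT => t; apply: cvgD; first exact: cvg_cst.
  apply: cvgZr_tmp; apply: cvgB; first exact: cvg_cst.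
  by apply: (cvg_comp _ _ (cvgN cvg_id)); exact: continuous_expR.
- move=> t _ i; rewrite decay_rhs decay_flow_source.
  under [X in is_derive _ _ X]eq_fun do rewrite decay_flowE.
  by apply: is_derive_eq; rewrite /GRing.scale/=; ring.
Qed.

(** Along a nonnegative solution [y i * expR] does not decrease: its derivative
    is [expR] times [y i' + y i], which vanishes for [i = a] and is a sum of
    nonnegative terms otherwise. *)
Lemma decay_positive : positive_pds decay.
Proof.
move=> y0 y00; split; first by exists (decay_flow y0); exact: decay_flow_solution.
move=> y [y0E ynn /continuous_within_itvcyP[_ ycont] yder] t t0 i.
pose u s := y s 0 i * expR s.
pose du s := (prod_term decay i (y s) - dest_term decay i (y s) + y s 0 i) * expR s.
have udu (s : R) : 0 < s -> is_derive s 1 u (du s).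
  move=> s0; have ? := yder s s0 i; apply: is_derive_eq; rewrite /du.
  rewrite /GRing.scale/=; ring.
have ucont : u s @[s --> 0^'+] --> u 0.
  apply: cvgM.
    have coordC : w 0 i @[w --> y 0] --> y 0 0 i by exact: coord_continuous.
    exact: cvg_comp ycont coordC.
  by apply: cvg_at_right_filter; exact: continuous_expR.
have du0 (s : R) : 0 < s -> 0 <= du s.
  move=> s0; rewrite /du decay_rhs mulr_ge0 ?expR_ge0//.
  have ya := ynn s (ltW s0) a; have yi := ynn s (ltW s0) i.
  case: (eqVneq i a) yi => [->|_] yi; first by rewrite (negbTE ab)/=; lra.
  by rewrite subr0 addr_ge0// mulr_ge0.
have [c /andP[c0 _]] := MVT_right t0 ucont udu.
rewrite subr0 => uE; have ut : u 0 <= u t.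
  by rewrite -subr_ge0 uE mulr_ge0 ?du0// ltW.
have : 0 < u t by apply: lt_le_trans ut; rewrite /u expR0 mulr1 y0E.
by rewrite /u pmulr_lgt0 ?expR_gt0.
Qed.

End Decay.

Lemma expRN_taylor2 {R : realType} :
  Oh 3 (fun h : R => expR (- h) - (1 - h + h ^+ 2 / 2)).
Proof.
have expN (x : R) : expR (- y) @[y --> x] --> expR (- x).
  by apply: (cvg_comp _ _ (cvgN cvg_id)); exact: continuous_expR.
have dexpN (x : R) : 0 < x ->
    is_derive x 1 (fun s => expR (- s)) (- expR (- x)).
  by move=> _; apply: is_derive_eq; rewrite /GRing.scale/=; ring.
have primitive k (c0 c1 : R) : Oh k (fun h => - expR (- h) - (c0 + c1 * h)) ->
    Oh k.+1 (fun h => expR (- h) - (1 + c0 * h + c1 / 2 * h ^+ 2)).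
  move=> e; have e' : Oh k (fun h => - expR (- (0 + h)) - (c0 + c1 * h)).
    by apply: (Oh_ext _ e) => h; rewrite add0r.
  have prim := @Oh_primitive R k (fun s => expR (- s)) _ 0 c0 c1
    (cvg_at_right_filter (expN 0)) dexpN e'.
  by apply: (Oh_ext _ prim) => h; rewrite add0r oppr0 expR0.
have e1 : Oh 1 (fun h : R => expR (- h) - (1 + 0 * h + 0 / 2 * h ^+ 2)).
  apply: primitive; apply: (Oh_ext (fun h => - expR (- h))).
    by apply/OhN/cvg_Oh/cvg_at_right_filter/expN.
  by move=> h; ring.
have e2 : Oh 2 (fun h : R => expR (- h) - (1 + -1 * h + 0 / 2 * h ^+ 2)).
  by apply: primitive; apply: (Oh_ext _ (OhN e1)) => h; field.
apply: (Oh_ext (fun h : R => expR (- h) - (1 + -1 * h + 1 / 2 * h ^+ 2))).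
  by apply: primitive; apply: (Oh_ext _ (OhN e2)) => h; field.
by move=> h; field.
Qed.

(** The source [a] receives nothing, so its equations are decoupled from the
    others: [y2 a = 1 / (1 + a21 h)], and
    [ynew a * (1 + h (b1 / y2 a + b2)) = 1]. *)
Lemma decay_step {R : realType} {N : nat} {a b : 'I_N} {delta a21 b1 b2 h : R}
    {ynew : 'rV[R]_N} :
  a != b -> b1 + b2 = 1 ->
  mprk delta a21 b1 b2 (decay a b) h (const_mx 1) ynew ->
  (1 + h + b1 * a21 * h ^+ 2) * ynew 0 a = 1.
Proof.
move=> ab bsum [y1 [y2 [y1E /(_ a) y2E /(_ a) ynewE]]].
have {}y1E : y1 = const_mx 1 by apply/rowP => i; rewrite y1E.
have pE j (y : 'rV[R]_N) : prod_rate (decay a b) a j y = 0.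
  by rewrite /= /decay_rate (negbTE ab) andbF.
have dE j (y : 'rV[R]_N) : dest_rate (decay a b) a j y = if j == b then y 0 a else 0.
  by rewrite /= /decay_rate eqxx.
move: (decay a b) pE dE y2E ynewE => S pE dE y2E ynewE.
have {}y2E : (1 + a21 * h) * y2 0 a = 1.
  move: y2E; rewrite (bigD1 b)//= big1 => [|j jb].
    rewrite pE dE eqxx y1E !mxE; move: (y2 0 a) (y2 0 b) => z zb.
    by rewrite !mul0r add0r mul1r divr1 addr0; lra.
  by rewrite pE dE (negbTE jb); ring.
have y2n0 : y2 0 a != 0.
  by apply/eqP => z; move: y2E; rewrite z mulr0 => /eqP; rewrite eq_sym oner_eq0.
have y2V : (y2 0 a)^-1 = 1 + a21 * h by apply: (mulIf y2n0); rewrite mulVf.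
move: ynewE; rewrite (bigD1 b)//= big1 => [|j jb]; last first.
  by rewrite !pE !dE (negbTE jb); ring.
rewrite !pE !dE eqxx y1E !mxE /= !mulr0 !addr0 mul0r mulr1 => ynewE.
have {}ynewE : ynew 0 a = 1 - h * (b1 * (1 + a21 * h) + b2) * ynew 0 a.
  by rewrite {1}ynewE -y2V; field.
have b2E : b2 = 1 - b1 by lra.
move: ynewE; rewrite b2E; move: (ynew 0 a) => w; lra.
Qed.

(** Applied to the linear decay started at [(1, ..., 1)], second order accuracy
    says that [(1 + h + b1 a21 h^2) (1 - h + h^2 / 2)] is [1 + O(h^3)]. *)
Lemma second_order_b1_a21 {R : realType} {N : nat} {delta a21 b1 b2 : R} :
  (2 <= N)%N -> delta = 0 \/ delta = 1 -> 0 <= a21 -> 0 <= b1 -> 0 <= b2 ->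
  b1 + b2 = 1 ->
  second_order_accurate (mprk delta a21 b1 b2 : one_step_method R N) ->
  b1 * a21 = 1 / 2.
Proof.
move=> N2 d01 a0 b10 b20 bsum acc.
pose a : 'I_N := Ordinal (ltnW N2); pose b : 'I_N := Ordinal N2.
have ab : a != b by [].
have one0 : pos_vec (const_mx 1 : 'rV[R]_N) by move=> i; rewrite mxE.
have /choice[ynew step] : forall h : R, exists w : 'rV[R]_N, 0 <= h ->
    mprk delta a21 b1 b2 (decay a b) h (const_mx 1) w.
  move=> h; have [h0|h0] := leP 0 h; last by exists 0.
  have [w [w_step _]] := mprk_solvable d01 a0 b10 b20 (decay_conservative _ _ ab) h0 one0.
  by exists w.
have err : Oh 3 (fun h => ynew h 0 a - (1 - h + h ^+ 2 / 2)).
  have step_near : \forall h \near 0^'+,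
      mprk delta a21 b1 b2 (decay a b) h (const_mx 1) (ynew h).
    by near=> h; apply: step.
  have := acc _ (decay_positive _ _ ab) (decay_conservative _ _ ab) 0 _ one0 _
    (decay_flow_solution _ _ ab _ one0) ynew step_near a.
  move=> acc_a; apply: (Oh_ext _ (OhD acc_a expRN_taylor2)) => h.
  by rewrite add0r decay_flow_source// mxE; ring.
pose beta := b1 * a21.
have err' : Oh 3 (fun h => 1 - (1 + h + beta * h ^+ 2) * (1 - h + h ^+ 2 / 2)).
  apply: (Oh_near (fun h => (1 + h + beta * h ^+ 2) *
      (ynew h 0 a - (1 - h + h ^+ 2 / 2)))).
    apply: (OhM (k := 0)) => //; apply: OhD; first apply: OhD.
    - exact: Oh_cst.
    - exact: Oh_weaken (Oh_exp 1).
    - by apply: OhZ; apply: Oh_weaken (Oh_exp 2).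
  near=> h; have h0 : 0 <= h by [].
  by rewrite mulrBr (decay_step ab bsum (step h h0)).
have half : Oh 3 (fun h : R => (1 / 2 - beta) * h ^+ 2).
  (* The terms of degree 3 and 4 of the product of the two polynomials. *)
  have rest := OhM (Oh_exp 3) (OhD (Oh_cst (1 / 2 - beta))
    (OhZ (beta / 2) (Oh_weaken (leq0n 1) (Oh_exp 1)))).
  apply: (Oh_ext _ (OhD err' rest)) => h.
  by field.
by have := Oh_coef0 half; rewrite /beta; lra.
Unshelve. all: by end_near. Qed.

(** * The characterization *)

Theorem theorem3p5 (R : realType) (N : nat) (delta a21 b1 b2 : R)
    (N_ge2 : (2 <= N)%N) (delta01 : delta = 0 \/ delta = 1)
    (a21_ge0 : 0 <= a21) (b1_ge0 : 0 <= b1) (b2_ge0 : 0 <= b2)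
    (b_sum : b1 + b2 = 1) (order2 : a21 * b2 = 1 / 2) :
  second_order_accurate (mprk delta a21 b1 b2 : one_step_method R N) <->
  a21 = 1.
Proof.
split=> [acc|a21_1].
  have half := second_order_b1_a21 N_ge2 delta01 a21_ge0 b1_ge0 b2_ge0 b_sum acc.
  have b1E : b1 = 1 - b2 by lra.
  by move: half; rewrite b1E; lra.
have b2_half : b2 = 1 / 2 by rewrite -order2 a21_1 mul1r.
have b1_half : b1 = 1 / 2 by lra.
move=> S _ _ tn yn yn0 y ysol ynew step i.
have /near_choice[y2 scheme] : \forall h \near 0^'+, exists y2 : 'rV[R]_N,
    mprk_eqs delta a21 b1 b2 S yn y2 h yn yn y2 (ynew h).
  apply: filterS step => h [y1 [y2 eqs]]; exists y2.
  have [y1E _ _] := eqs; have {}y1E : y1 = yn by apply/rowP => j; rewrite y1E.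
  by move: eqs; rewrite y1E.
have num := step_taylor2 yn0 scheme a21_1 b1_half b2_half i.
apply: (Oh_ext _ (OhB num (solution_taylor2 i yn0 ysol))) => h; ring.
Qed.
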